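(* Let $\mathbb{H}\subset\mathbb{N}$, let $n\in\mathbb{N}$, and let $\mathcal{C}(n,\mathbb{H})$ be the circle of partition generated by $n$ with respect to $\mathbb{H}$. Suppose that the limits below exist and that $$\lim_{k\to\infty}\frac{|\mathbb{H}\cap\mathbb{N}_k|}{k}>0\quad\text{and}\quad \lim_{k\to\infty}\frac{|(\mathbb{N}\setminus\mathbb{H})\cap\mathbb{N}_k|}{k}<\frac12\lim_{k\to\infty}\frac{|\mathbb{H}\cap\mathbb{N}_k|}{k}.$$ Then $\mathcal{C}(n,\mathbb{H})$ is ascending at infinitely many spots, i.e. there are infinitely many $m>n$ with $\nu(n,\mathbb{H})<\nu(m,\mathbb{H})$.
   Context: $\mathbb{N}=\{1,2,\dots\}$ and $\mathbb{N}_k=\{1,\dots,k\}$. For $n\in\mathbb{N}$ and $\mathbb{M}\subseteq\mathbb{N}$, the circle of partition is $\mathcal{C}(n,\mathbb{M})=\{[x]: x,y\in\mathbb{M},\ x+y=n\}$. An axis of $\mathcal{C}(n,\mathbb{M})$ is an unordered pair of distinct points $[x],[y]\in\mathcal{C}(n,\mathbb{M})$ with $x+y=n$ (the center $[n/2]$, if present, is not an axis point), and $\nu(n,\mathbb{M})$ is the number of axes, i.e. the number of unordered pairs $\{x,y\}\subseteq\mathbb{M}$ with $x\ne y$, $x+y=n$. $\mathcal{C}(n,\mathbb{M})$ is called ascending from $n$ to the spot $m$ if $n<m$ and $\nu(n,\mathbb{M})<\nu(m,\mathbb{M})$. *)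

(* Defs.v *)
From HB Require Import structures.
From mathcomp Require Import all_boot all_order all_algebra finmap.
From mathcomp Require Import all_classical all_reals all_analysis.
Import Order.TTheory GRing.Theory Num.Theory.
Import numFieldNormedType.Exports.

Set Implicit Arguments.
Unset Strict Implicit.
Unset Printing Implicit Defensive.

Local Open Scope classical_set_scope.

(* The natural numbers start at 1 here, whereas [nat] contains 0. *)
Definition posnat : set nat := [set x | 0 < x].

Definition initial_segment (k : nat) : set nat := [set x | 0 < x <= k].

(* The point [x] of a circle of partition is identified with its weight x. *)
Definition circle_of_partition (n : nat) (M : set nat) : set nat :=
  [set x | M x /\ exists2 y, M y & x + y = n].

(* An axis is an unordered pair of points, i.e., a two-element finite set. *)
Definition axes (n : nat) (M : set nat) : set {fset nat} :=
  [set a | exists x y, [/\ circle_of_partition n M x,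
                           circle_of_partition n M y,
                           x <> y, x + y = n & a = [fset x; y]%fset]].

(* [fset_set] returns the empty set on infinite sets; [axes n M] is finite,
   since both points of an axis are at most n. *)
Definition num_axes (n : nat) (M : set nat) : nat := #|` fset_set (axes n M)|.

Definition ascending (M : set nat) (n m : nat) : Prop :=
  n < m /\ num_axes n M < num_axes m M.

(* The term at k = 0 is 0 and does not affect the limit. *)
Definition density_seq (R : realType) (A : set nat) : nat -> R :=
  fun k => (#|` fset_set (A `&` initial_segment k)|%:R / k%:R)%R.

Definition density (R : realType) (A : set nat) : R :=
  limn (density_seq R A).

(* Main.v *)
(** Among the (m-1)/2 pairs {x, m-x} with 2x < m, at most as many fail to be
    axes as there are numbers up to m outside H, since distinct pairs are
    disjoint. The limits make this number less than half of |H ∩ N_m|,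
    hence less than m/3, for all large m.  So [num_axes m H] grows at
    least like m/6, and every large m is a spot at which the circle ascends. *)
Require Import Defs.
From HB Require Import structures.
From mathcomp Require Import all_boot all_order all_algebra finmap.
From mathcomp Require Import all_classical all_reals all_analysis.
From mathcomp Require Import zify lra.
Import Order.TTheory GRing.Theory Num.Theory.
Import numFieldNormedType.Exports.
Local Open Scope classical_set_scope.
Local Open Scope ring_scope.

Lemma leq_size_fset_set (T : choiceType) (A : set T) (s : seq T) :
  finite_set A -> uniq s -> (forall x, x \in s -> A x) ->
  (size s <= #|` fset_set A|)%N.
Proof.
move=> finA us sA; apply: uniq_leq_size => // x /sA Ax.
by rewrite in_fset_set// inE.
Qed.

Lemma finite_initial_segment (A : set nat) (k : nat) :
  finite_set (A `&` initial_segment k).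
Proof.
apply: (sub_finite_set _ (finite_II k.+1)) => x [_ /=].
by case/andP.
Qed.

Lemma finite_axes (m : nat) (M : set nat) : finite_set (axes m M).
Proof.
(* One point of an axis determines the other, so every axis is an image of some [x <= m]. *)
apply: (sub_finite_set _ (finite_image (fun x => [fset x; (m - x)%N]%fset)
  (finite_II m.+1))) => a [x [y [_ _ _ xy ->]]].
exists x; first by rewrite /=; lia.
by rewrite -xy addKn.
Qed.

(** Both sets lie in {1, ..., k} and they are disjoint. With [2 * c < h] this will give
    [3 * c < m]. *)
Lemma card_initial_segment_compl (A : set nat) (k : nat) :
  (#|` fset_set (A `&` initial_segment k)| +
   #|` fset_set ((posnat `\` A) `&` initial_segment k)| <= k)%N.
Proof.
set B := fset_set _; set C := fset_set _.
have uBC : uniq (B ++ C).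
  rewrite cat_uniq !fset_uniq /= andbT; apply/hasPn => x.
  rewrite !in_fset_set; try exact: finite_initial_segment.
  by rewrite !inE => -[[_ nAx] _]; apply/negP; rewrite inE => -[].
rewrite -size_cat -[leqRHS](size_iota 1); apply: uniq_leq_size => // x.
rewrite mem_cat !in_fset_set; try exact: finite_initial_segment.
by move=> /orP[]; rewrite inE mem_iota => -[_ /andP[]]; lia.
Qed.

Lemma num_axes_ge (m : nat) (M : set nat) :
  (m.-1./2 <=
   num_axes m M + #|` fset_set ((posnat `\` M) `&` initial_segment m)|)%N.
Proof.
pose p x := `[< M x >]; pose s := iota 1 m.-1./2; pose r x := (m - x)%N.
(* [good] holds the smaller points of axes; [bad] holds the numbers outside [M] among all [x] and
   [m - x], so the center is in neither. *)
pose good := [seq x <- s | p x && p (r x)].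
pose bad := [seq x <- s ++ map r s | ~~ p x].
have ms x : x \in s -> (0 < x)%N && (x.*2 < m)%N by rewrite mem_iota; lia.
have le_good : (size good <= num_axes m M)%N.
  pose f x := [fset x; r x]%fset.
  rewrite -(size_map f); apply: leq_size_fset_set; first exact: finite_axes.
    (* The pair determines [x] as its smaller element: [x = m - y] is impossible when [2x < m] and
       [2y < m]. *)
    rewrite map_inj_in_uniq ?filter_uniq ?iota_uniq// => x y.
    rewrite !mem_filter => /andP[_ /ms xm] /andP[_ /ms ym] /fsetP/(_ x).
    by rewrite !inE eqxx /r /= => /esym/orP[]/eqP; lia.
  move=> _ /mapP[x + ->]; rewrite mem_filter.
  move=> /andP[/andP[/asboolP Mx /asboolP Mrx] /ms xm].
  exists x, (r x); split=> //; rewrite /r; try lia.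
  - by split=> //; exists (r x) => //; rewrite /r; lia.
  - by split=> //; exists x => //; rewrite /r; lia.
have le_bad : (size bad <=
    #|` fset_set ((posnat `\` M) `&` initial_segment m)|)%N.
  apply: leq_size_fset_set; first exact: finite_initial_segment.
    rewrite filter_uniq// cat_uniq iota_uniq /= map_inj_in_uniq ?iota_uniq.
      (* Reflection sends numbers below [m/2] to numbers above it, so the two halves share no
         element. *)
      rewrite andbT; apply/hasPn => _ /mapP[x /ms xm ->].
      by apply/negP => /ms; rewrite /r; lia.
    by move=> x y /ms xm /ms ym; rewrite /r; lia.
  move=> x; rewrite mem_filter mem_cat => /andP[/asboolP nMx xs].
  have xm : (0 < x <= m)%N.
    by case/orP: xs => [/ms|/mapP[y /ms ym ->]]; rewrite /r; lia.
  by split=> //; split=> //; case/andP: xm.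
apply: leq_trans (leq_add le_good le_bad).
rewrite /bad filter_cat size_cat filter_map size_map !size_filter.
rewrite -[leqLHS](size_iota 1) -/s.
(* Each [x] in [s] adds one to the first count or at least one to the other two. *)
elim: s {ms good bad le_good le_bad} => //= x s IHs.
by case: (p x); case: (p (r x)) => /=; lia.
Qed.

Lemma eventually_infinite_set (A : set nat) (N : nat) :
  (forall m, (N <= m)%N -> A m) -> infinite_set A.
Proof.
move=> NA finA; apply: infinite_nat.
apply: (sub_finite_set _ (_ : finite_set (A `|` `I_N))).
  by move=> m _; case: (leqP N m) => [/NA|]; [left|right].
by rewrite finite_setU; split=> //; exact: finite_II.
Qed.

Theorem theorem5p2 (R : realType) (H : set nat) (n : nat)
  (H_pos : H `<=` posnat) (n_pos : (0 < n)%N)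
  (cvg_H : cvgn (density_seq R H))
  (cvg_compl : cvgn (density_seq R (posnat `\` H)))
  (density_H_gt0 : 0 < density R H)
  (density_compl_lt : density R (posnat `\` H) < 1 / 2 * density R H) :
  infinite_set [set m : nat | ascending H n m].
Proof.
pose e := (1 / 2 * density R H - density R (posnat `\` H)).
pose u k := 1 / 2 * density_seq R H k - density_seq R (posnat `\` H) k.
(* The gap [e] between the two sides of the density hypothesis is the limit of [u], so [u] is
   eventually positive. *)
have cvg_u : u @ \oo --> e by apply: cvgB => //; apply: cvgMr.
have e_gt0 : 0 < e by rewrite subr_gt0.
have [N _ uN] : \forall k \near \oo, 0 < u k by exact: (cvgr_gt _ cvg_u).
(* [N] makes [u m] positive and [n] gives [n < m]. From [3 * c < m] follows
   [6 * num_axes m H >= m - 4], which exceeds [6 * num_axes n H]. *)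
apply: (@eventually_infinite_set _ (N + n + 6 * num_axes n H + 12)) => m leNm.
have := card_initial_segment_compl H m; have := num_axes_ge m H.
have : 0 < u m by apply: uN => /=; lia.
rewrite /u /density_seq mulrA -mulrBl.
(* Clearing the common denominator [m > 0] turns the densities into counts. *)
rewrite pmulr_lgt0; last by rewrite invr_gt0 ltr0n; lia.
set h := #|` _|; set c := #|` _| => hc ? ?.
have {}hc : (2 * c < h)%N by rewrite -(ltr_nat R) natrM; lra.
by split; lia.
Qed.
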